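(* Let $k,n,L$ be positive integers with $2k<n$. Then $$n-2k-\frac{(k+1)(n-k)}{L+1}\;\le\; p^{AS}(n,k,L)\;\le\; p^{AAD}(n,k,L-1)\;\le\; n-2k .$$ Moreover, for $k=1$ (and $n\ge 3$) one has $p^{AS}(n,1,L)=n-2$ for every integer $L\ge n$, and for $k=2$ (and $n\ge 5$) one has $p^{AAD}(n,2,L)=n-4$ for every integer $L\ge 4n^2-18n+21$.
   Context: Let $q$ be a prime power and $\mathbb{F}_q$ the field with $q$ elements. A partial $k$-spread in $\mathbb{F}_q^n$ is a collection of $k$-dimensional linear subspaces with pairwise trivial intersection (i.e. equal to $\{0\}$). For $u\in\mathbb{F}_q^n$ and a subspace $S$, $u+S=\{u+v: v\in S\}$. Let $k,n$ be positive integers with $2k<n$ and let $L\ge 0$ be an integer. A family $\mathcal{F}$ of $k$-dimensional linear subspaces of $\mathbb{F}_q^n$ is $L$-almost affinely disjoint, written $[n,k,L]_q$-AAD, if (1) $\mathcal{F}$ is a partial $k$-spread of $\mathbb{F}_q^n$, and (2) for every $S\in\mathcal{F}$ and every $u\in\mathbb{F}_q^n\setminus S$, the affine subspace $u+S$ intersects (has nonempty intersection with) at most $L$ subspaces from $\mathcal{F}$. A family $\mathcal{F}$ of $k$-dimensional linear subspaces of $\mathbb{F}_q^n$ is $L$-almost sparse, written $[n,k,L]_q$-AS, if (1) $\mathcal{F}$ is a partial $k$-spread of $\mathbb{F}_q^n$, and (2) every $(k+1)$-dimensional linear subspace of $\mathbb{F}_q^n$ intersects non-trivially (in more than $\{0\}$)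 at most $L$ subspaces from $\mathcal{F}$. $m^{AAD}_q(n,k,L)$ and $m^{AS}_q(n,k,L)$ denote the maximal cardinality of an $[n,k,L]_q$-AAD, respectively $[n,k,L]_q$-AS, family. With $q$ ranging over prime powers and $L$ fixed, define $$p^{AAD}(n,k,L):=\limsup_{q\to\infty}\log_q\big(m^{AAD}_q(n,k,L)\big),\qquad p^{AS}(n,k,L):=\limsup_{q\to\infty}\log_q\big(m^{AS}_q(n,k,L)\big).$$ *)

(* Defs.v *)
From HB Require Import structures.
From mathcomp Require Import all_boot all_order all_algebra all_field.
From mathcomp Require Import all_classical all_reals all_analysis.

Set Implicit Arguments.
Unset Strict Implicit.
Unset Printing Implicit Defensive.

Import Order.TTheory GRing.Theory Num.Theory.

Local Open Scope ring_scope.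

(* Over a finite field there are finitely many subspaces, so that families of
   subspaces can be taken in [{set {vspace vT}}]. *)
HB.instance Definition _ (F : finFieldType) (vT : vectType F) :=
  isCountable.Build {vspace vT}
    (pcan_pickleK (can_pcan (@VectorInternalTheory.vs2mxK F vT))).
HB.instance Definition _ (F : finFieldType) (vT : vectType F) :=
  fintype.isFinite.Build {vspace vT}
    (pcan_enumP (can_pcan (@VectorInternalTheory.vs2mxK F vT))).

Section Families.
Variables (F : finFieldType) (n : nat).
Implicit Types (S T W : {vspace 'rV[F]_n}) (u : 'rV[F]_n).
Implicit Types (Fam : {set {vspace 'rV[F]_n}}) (k L : nat).

Definition partial_spread k Fam : bool :=
  [forall S in Fam, \dim S == k] &&
  [forall S in Fam, forall T in Fam, (S != T) ==> ((S :&: T)%VS == 0%VS)].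

Definition affine u S : {set 'rV[F]_n} := [set u + v | v in S]%SET.

Definition is_AAD k L Fam : bool :=
  partial_spread k Fam &&
  [forall S in Fam, forall u, (u \notin S) ==>
    (#|[set T in Fam | ~~ [disjoint affine u S & T]]%SET| <= L)%N].

Definition is_AS k L Fam : bool :=
  partial_spread k Fam &&
  [forall W : {vspace 'rV[F]_n}, (\dim W == k.+1) ==>
    (#|[set T in Fam | (W :&: T)%VS != 0%VS]%SET| <= L)%N].

End Families.

Definition prime_power (q : nat) : Prop :=
  exists p e : nat, [/\ prime p, (0 < e)%N & q = (p ^ e)%N].

Lemma finField_exists (q : nat) :
  prime_power q -> exists F : finFieldType, #|F| = q.
Proof.
move=> [p [e [p_pr e_gt0 ->]]].
by have [F _ cardF] := pPrimePowerField p_pr e_gt0; exists F.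
Qed.

(* A field with [q] elements, unique up to isomorphism; ['F_2] is a junk value
   used when [q] is not a prime power. *)
Definition GF (q : nat) : finFieldType :=
  if pselect (exists F : finFieldType, #|F| = q) is left exF
  then projT1 (cid exF) else 'F_2.

Lemma card_GF (q : nat) : prime_power q -> #|GF q| = q.
Proof.
move=> /finField_exists exF; rewrite /GF.
by case: pselect => [exF'|//]; case: (cid exF').
Qed.

Definition mAAD (q n k L : nat) : nat :=
  (\max_(Fam : {set {vspace 'rV[GF q]_n}} | is_AAD k L Fam) #|Fam|)%N.

Definition mAS (q n k L : nat) : nat :=
  (\max_(Fam : {set {vspace 'rV[GF q]_n}} | is_AS k L Fam) #|Fam|)%N.

Definition logb {R : realType} (b x : R) : R := ln x / ln b.

(* The upper limits are taken in [\bar R], along the prime powers only. The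
   convention [ln 0 = 0] is harmless when [0 < k < n]: a single subspace is an
   [n,k,L]-AAD family for all [L], and an [n,k,L]-AS family for all [L > 0]. *)
Definition pAAD (R : realType) (n k L : nat) : \bar R :=
  limf_esup (fun q : nat => (logb q%:R (mAAD q n k L)%:R)%:E)
            (within prime_power \oo%classic).

Definition pAS (R : realType) (n k L : nat) : \bar R :=
  limf_esup (fun q : nat => (logb q%:R (mAS q n k L)%:R)%:E)
            (within prime_power \oo%classic).

(* Main.v *)
(** Upper bound: fix [S] in an AAD family. Each other member [T] meets [u + S] for the
    [q^(2k) - q^k] points [u] of [(S + T) \ S], while each [u] outside [S] is met by at
    most [L] members, so the family has at most [(2L+1) q^(n-2k)] members. An AS family
    with bound [L] is an AAD family with bound [L-1], because [S + <u>] has dimension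
    [k+1] and also meets [S].

    Constructions: let [E] be the extension of degree [m] of [F_q]. Members are graphs
    [{(v, v A_x)}] with [x] in [E], and the translate by
    [(0, w)] of the [x]-th member meets the [y]-th one iff [w = v (A_y - A_x)] is solvable.
    - [v A_x = (sum_i v_i th^i) x] gives a partial spread of [q^(n-k)] members, of which
      a [(k+1)]-space meets at most [2 q^k]. There are at most [q^((k+1)(n-k))] such
      spaces, so by counting some subset of size about [q^(n-2k-(k+1)(n-k)/(L+1))] has at
      most [L] members meeting any of them.
    - For [k = 1], restrict [x] to a large fibre of the norm; solutions [y] lie on an
      [F_q]-line, on which the norm is a polynomial of degree exactly [m = n-1]. In
      dimension [k = 1] an AAD family with bound [L] is an AS family with bound [L+1].
    - For [k = 2], take [m = n-3], again a fibre of the norm, and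
      [v A_x = ((v_0 + v_1 th) x, v_1 Tr x)]: the trace coordinate leaves at most [m + 1]
      directions [v] up to scaling, each of which contributes at most [m] solutions. *)
Require Import Defs.
From mathcomp Require Import all_boot all_order all_algebra all_field.
From mathcomp Require Import all_classical all_reals all_analysis.
From mathcomp Require Import cyclic zify ring lra.

Set Implicit Arguments.
Unset Strict Implicit.
Unset Printing Implicit Defensive.

Import Order.TTheory GRing.Theory Num.Theory.

Local Open Scope ring_scope.

(** * Upper limits along prime powers *)

Section LimsupPrimePowers.
Variable R : realType.
Implicit Types (M : nat -> nat) (e : R).

Let F := within prime_power \oo%classic.
Let pow M := fun q : nat => (logb q%:R (M q)%:R : R)%:E.

Lemma prime_power_gt1 q : prime_power q -> (1 < q)%N.
Proof.
by move=> [p [e [p_pr e_gt0 ->]]]; rewrite (ltn_exp2l 0) // prime_gt1.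
Qed.

Lemma within_prime_power_ge (Q : nat) :
  F [set q | prime_power q /\ (Q <= q)%N]%classic.
Proof. by exists Q => // q /= leQq ppq; split. Qed.

(** Primes are unbounded, so the filter is proper; this is what lets an eventual lower bound pass to
    the upper limit. *)
Lemma within_prime_power_meets (A : set nat) Q :
  F A -> exists q, [/\ A q, prime_power q & (Q <= q)%N].
Proof.
case=> N _ sub; have [p p_gt p_pr] := prime_above (maxn N Q).
have ppp : prime_power p by exists p, 1%N; rewrite expn1.
exists p; split=> //; last by rewrite (leq_trans (leq_maxr N Q)) // ltnW.
by apply: sub => //=; rewrite (leq_trans (leq_maxl N Q)) // ltnW.
Qed.

Lemma le_limf_esup_prime_power (u v : nat -> \bar R) Q :
  (forall q, prime_power q -> (Q <= q)%N -> (u q <= v q)%E) ->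
  (limf_esup u F <= limf_esup v F)%E.
Proof.
move=> leuv; apply: le_ereal_inf_tmp => _ [A FA <-].
have FB : F (A `&` [set q | prime_power q /\ (Q <= q)%N])%classic.
  by apply: filterI => //; exact: within_prime_power_ge.
apply: (le_trans (ereal_inf_lbound _)).
  by exists (A `&` [set q | prime_power q /\ (Q <= q)%N])%classic.
apply: ub_ereal_sup => _ [q [Aq [ppq leQq]] <-].
apply: (le_trans (leuv _ ppq leQq)); apply: ereal_sup_ubound.
by exists q.
Qed.

Lemma limf_esup_prime_power_ge (u : nat -> \bar R) (a : \bar R) Q :
  (forall q, prime_power q -> (Q <= q)%N -> (a <= u q)%E) ->
  (a <= limf_esup u F)%E.
Proof.
move=> leau; apply: le_ereal_inf_tmp => _ [A FA <-].
have [q [Aq ppq leQq]] := within_prime_power_meets Q FA.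
by apply: (le_trans (leau _ ppq leQq)); apply: ereal_sup_ubound; exists q.
Qed.

Lemma limf_esup_prime_power_le (u : nat -> \bar R) (a : \bar R) Q :
  (forall q, prime_power q -> (Q <= q)%N -> (u q <= a)%E) ->
  (limf_esup u F <= a)%E.
Proof.
move=> leua; apply: (le_trans (ereal_inf_lbound _)).
  by exists [set q | prime_power q /\ (Q <= q)%N]%classic;
     first exact: within_prime_power_ge.
by apply: ub_ereal_sup => _ [q [ppq leQq] <-]; exact: leua.
Qed.

(** A constant factor [C] costs at most [eps] in the exponent, so multiplicative constants disappear
    from [limsup_logb_ge] and [limsup_logb_le]. *)
Lemma eventually_small_log (C eps : R) : 0 < eps ->
  exists Q, forall q, prime_power q -> (Q <= q)%N -> ln C <= eps * ln (q%:R : R).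
Proof.
move=> eps_gt0; exists (Num.truncn (expR (ln C / eps))).+1 => q ppq leQq.
rewrite mulrC -ler_pdivrMr //.
have q_gt0 : 0 < q%:R :> R by rewrite ltr0n ltnW // prime_power_gt1.
rewrite -ler_expR lnK ?posrE //; apply/ltW/(lt_le_trans (truncnS_gt _)).
by rewrite ler_nat.
Qed.

Lemma ln_prime_power_gt0 q : prime_power q -> 0 < ln (q%:R : R).
Proof. by move=> ppq; rewrite ln_gt0 // ltr1n prime_power_gt1. Qed.

Lemma ln_nat_ge0 (x : nat) : 0 <= ln (x%:R : R).
Proof. by case: x => [|x]; [rewrite ln0 | rewrite ln_ge0 // ler1n]. Qed.

Lemma limsup_logb_ge0 M : (0 <= limf_esup (pow M) F)%E.
Proof.
apply: (limf_esup_prime_power_ge (Q := 0)) => q ppq _.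
by rewrite lee_fin divr_ge0 ?ln_nat_ge0.
Qed.

Lemma le_limsup_logb M N :
  (forall q, prime_power q -> (M q <= N q)%N) ->
  (limf_esup (pow M) F <= limf_esup (pow N) F)%E.
Proof.
move=> leMN; apply: (le_limf_esup_prime_power (Q := 0)) => q ppq _.
rewrite lee_fin ler_pM2r ?invr_gt0 ?ln_prime_power_gt0 //.
have := leMN q ppq; case: (M q) => [|x] lexN; first by rewrite ln0 // ln_nat_ge0.
by rewrite ler_ln ?posrE ?ltr0n ?ler_nat // (leq_trans _ lexN).
Qed.

Lemma limsup_logb_ge M (C e : R) Q : 0 < C ->
  (forall q, prime_power q -> (Q <= q)%N -> q%:R `^ e <= C * (M q)%:R) ->
  (e%:E <= limf_esup (pow M) F)%E.
Proof.
move=> C_gt0 leM; apply/lee_addgt0Pr => eps eps_gt0.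
rewrite -leeBlDr // -EFinB; have [Q' leQ'] := eventually_small_log C eps_gt0.
apply: (limf_esup_prime_power_ge (Q := maxn Q Q')) => q ppq.
rewrite geq_max => /andP[leQq leQ'q].
have q_gt0 : 0 < q%:R :> R by rewrite ltr0n ltnW // prime_power_gt1.
have := leM q ppq leQq; have := powR_gt0 e q_gt0 => qe_gt0 leqe.
have M_gt0 : 0 < (M q)%:R :> R by rewrite -(pmulr_rgt0 _ C_gt0) (lt_le_trans qe_gt0).
have := leqe; rewrite -ler_ln ?posrE ?mulr_gt0 // ln_powR lnM ?posrE // => le1.
rewrite lee_fin ler_pdivlMr ?ln_prime_power_gt0 //.
have := leQ' q ppq leQ'q; lra.
Qed.

Lemma limsup_logb_le M (C e : R) Q : 1 <= C -> 0 <= e ->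
  (forall q, prime_power q -> (Q <= q)%N -> (M q)%:R <= C * q%:R `^ e) ->
  (limf_esup (pow M) F <= e%:E)%E.
Proof.
move=> C_ge1 e_ge0 leM; have C_gt0 : 0 < C by exact: lt_le_trans C_ge1.
apply/lee_addgt0Pr => eps eps_gt0; have [Q' leQ'] := eventually_small_log C eps_gt0.
apply: (limf_esup_prime_power_le (Q := maxn Q Q')) => q ppq.
rewrite geq_max => /andP[leQq leQ'q].
have q_gt0 : 0 < q%:R :> R by rewrite ltr0n ltnW // prime_power_gt1.
have lnq := ln_prime_power_gt0 ppq.
rewrite lee_fin ler_pdivrMr //; have le1 := leQ' q ppq leQ'q.
(* Here [ln 0 = 0], and [0 <= e] closes the case. *)
have [->|M_gt0] := posnP (M q).
  by rewrite ln0 // mulr_ge0 ?ltW // ltr_wpDl.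
have := leM q ppq leQq.
rewrite -ler_ln ?posrE ?(mulr_gt0 C_gt0) ?powR_gt0 ?(ltr0n _ (M q)) //.
by rewrite lnM ?posrE ?powR_gt0 // ln_powR; lra.
Qed.

End LimsupPrimePowers.

(** * Sparse subsets by counting *)

Lemma ffact_leq_exp n j : (n ^_ j <= n ^ j)%N.
Proof.
elim: j n => [|j IHj] [|n] //; rewrite ffactSS expnS leq_mul2l /=.
by rewrite (leq_trans (IHj n)) //; case: j {IHj} => // j; rewrite leq_exp2r.
Qed.

(** Factor by factor this is [(m - i) / m <= (n - i) / n]. *)
Lemma ffact_exp_leq m n j : (m <= n)%N -> (m ^_ j * n ^ j <= n ^_ j * m ^ j)%N.
Proof.
move=> le_mn; elim: j => [|j IHj]; first by rewrite !ffactn0 !expn0.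
rewrite !ffactnSr !expnSr mulnACA [leqRHS]mulnACA leq_mul //.
by rewrite !mulnBl mulnC leq_sub2l // leq_mul2l le_mn orbT.
Qed.

(** Both sides count the [m]-subsets of an [n]-set together with [j] distinct elements listed in
    order, choosing either the list or the subset first. *)
Lemma bin_ffact_sub n m j : (j <= m)%N -> (m <= n)%N ->
  ('C(n - j, m - j) * n ^_ j = 'C(n, m) * m ^_ j)%N.
Proof.
elim: j n m => [|j IHj] n m; first by rewrite !subn0 !ffactn0.
case: n m => [|n] [|m] // le_jm le_mn.
rewrite !subSS !ffactSS mulnCA IHj // !mulnA (mul_bin_diag n.+1) /=.
by congr (_ * _)%N; rewrite mulnC.
Qed.

Lemma card_supersets (T : finType) (C : {set T}) (M : nat) :
  (#|[set A : {set T} | (C \subset A) && (#|A| == M)]%SET|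
     <= 'C(#|T| - #|C|, M - #|C|))%N.
Proof.
rewrite -[in X in (_ <= X)%N](cardsC C) addKn -cards_draws.
rewrite -(card_in_imset (f := fun A => (A :\: C)%SET)); last first.
  move=> A B; rewrite !inE => /andP[CA _] /andP[CB _] AB.
  rewrite -(finset.setID A C) -(finset.setID B C) AB.
  by rewrite (finset.setIidPr CA) (finset.setIidPr CB).
apply/subset_leq_card/fintype.subsetP=> _ /imsetP[A + ->].
rewrite !inE => /andP[CA /eqP<-]; rewrite cardsD (finset.setIidPr CA) eqxx andbT.
by rewrite finset.setDE subsetIr.
Qed.

(** First-moment argument: if every [M]-subset were bad, a union bound over the pairs of an index
    [i] and an [(L+1)]-subset of [B i] would have to cover all ['C(N, M)] of them. *)
Lemma exists_sparse_subset (T I : finType) (P : pred I) (B : I -> {set T})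
    (D M L : nat) :
  (forall i, P i -> (#|B i| <= D)%N) -> (M <= #|T|)%N ->
  (#|P| * (D * M) ^ L.+1 < #|T| ^ L.+1)%N ->
  exists A : {set T}, #|A| = M /\ forall i, P i -> (#|A :&: B i| <= L)%N.
Proof.
move=> leBD leMT lt_T; set N := #|T| in leMT lt_T.
pose good (A : {set T}) := [forall i, P i ==> (#|A :&: B i| <= L)%N].
suff /existsP[A /andP[/eqP oA /forallP gA]] :
    [exists A : {set T}, (#|A| == M) && good A].
  by exists A; split=> // i Pi; exact: (implyP (gA i)).
apply/contraT; rewrite negb_exists => /forallP bad.
have [le_ML | lt_LM] := leqP M L.
  have [A oA] : exists A : {set T}, #|A| = M.
    have : (0 < #|[set A : {set T} | #|A| == M]%SET|)%N.
      by rewrite card_draws bin_gt0.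
    by case/card_gt0P=> A; rewrite inE => /eqP; exists A.
  have /negP[] := bad A; rewrite oA eqxx; apply/forallP=> i; apply/implyP=> _.
  by rewrite (leq_trans (subset_leq_card (finset.subsetIl _ _))) // oA.
(* A bad [A] contains an [(L+1)]-subset [C] of some [B i], so it is counted at least once on the
   right. *)
have leCM : ('C(N, M) <=
    \sum_(i | P i) \sum_(C : {set T} | (C \subset B i) && (#|C| == L.+1))
       #|[set A : {set T} | (C \subset A) && (#|A| == M)]%SET|)%N.
  rewrite /N -card_draws -sum1_card.
  have le1 (A : {set T}) : #|A| == M -> (1 <=
    \sum_(i | P i) \sum_(C : {set T} | (C \subset B i) && (#|C| == L.+1))
      ((C \subset A) && (#|A| == M)))%N.
    move=> oA; have := bad A; rewrite oA negb_forall => /existsP[i].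
    rewrite negb_imply -ltnNge => /andP[Pi ltL].
    have /card_gt0P[C] : (0 < #|[set C : {set T} | (C \subset A :&: B i)
                                    & #|C| == L.+1]%SET|)%N.
      by rewrite cards_draws bin_gt0.
    rewrite inE finset.subsetI => /andP[/andP[CA CB] oC].
    by rewrite (bigD1 i) //= (bigD1 C) ?CB ?oC //= CA.
  rewrite (eq_bigl (fun A : {set T} => #|A| == M)) => [|A]; last by rewrite inE.
  apply: leq_trans (leq_sum _ le1) _; rewrite exchange_big; apply: leq_sum => i _.
  rewrite exchange_big; apply: leq_sum => C _.
  rewrite -sum1_card big_mkcond [leqRHS]big_mkcond /=; apply: leq_sum => A _.
  by rewrite inE; case: (C \subset A); case: (#|A| == M).
have le2 : ('C(N, M) <= #|P| * ('C(D, L.+1) * 'C(N - L.+1, M - L.+1)))%N.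
  apply: leq_trans leCM _; rewrite -sum_nat_const; apply: leq_sum => i Pi.
  apply: (@leq_trans ('C(#|B i|, L.+1) * 'C(N - L.+1, M - L.+1))); last first.
    by rewrite leq_mul2r leq_bin2l ?orbT // leBD.
  rewrite -cards_draws -sum_nat_const.
  rewrite [leqRHS](eq_bigl (fun C : {set T} => (C \subset B i) && (#|C| == L.+1)));
    last by move=> C; rewrite inE.
  by apply: leq_sum => C /andP[_ /eqP oC]; rewrite -oC card_supersets.
have CNM : (0 < 'C(N, M))%N by rewrite bin_gt0.
have binD : ('C(D, L.+1) <= D ^ L.+1)%N.
  rewrite (leq_trans _ (ffact_leq_exp D L.+1)) // -bin_ffact leq_pmulr //.
  exact: fact_gt0.
have le3 : (N ^_ L.+1 <= #|P| * (D ^ L.+1 * M ^_ L.+1))%N.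
  rewrite -(leq_pmul2l CNM) (leq_trans (leq_mul le2 (leqnn _))) //.
  rewrite -!mulnA bin_ffact_sub //.
  have -> : (#|P| * ('C(D, L.+1) * ('C(N, M) * M ^_ L.+1)) =
             'C(D, L.+1) * ('C(N, M) * (#|P| * M ^_ L.+1)))%N by ring.
  have -> : ('C(N, M) * (#|P| * (D ^ L.+1 * M ^_ L.+1)) =
             D ^ L.+1 * ('C(N, M) * (#|P| * M ^_ L.+1)))%N by ring.
  by rewrite leq_mul2r binD orbT.
have NL : (0 < N ^_ L.+1)%N by rewrite ffact_gt0 (leq_trans lt_LM).
(* Falling factorials are traded for powers, since [M ^_ L.+1 / N ^_ L.+1] is at most
   [(M / N) ^ L.+1]; this contradicts [lt_T]. *)
have : (N ^_ L.+1 * N ^ L.+1 <= N ^_ L.+1 * (#|P| * (D * M) ^ L.+1))%N.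
  apply: leq_trans (leq_mul le3 (leqnn _)) _.
  have -> : (N ^_ L.+1 * (#|P| * (D * M) ^ L.+1) =
             #|P| * D ^ L.+1 * (N ^_ L.+1 * M ^ L.+1))%N by rewrite expnMn; ring.
  by rewrite mulnA -mulnA leq_mul // ffact_exp_leq.
by rewrite leq_pmul2l // leqNgt lt_T.
Qed.

(** * AS versus AAD families, and the upper bound *)

Section Families.
Variables (F : finFieldType) (n : nat).
Implicit Types (S T W : {vspace 'rV[F]_n}) (u : 'rV[F]_n).
Implicit Types (Fam : {set {vspace 'rV[F]_n}}) (k L : nat).
Local Notation q := #|F|.

Lemma partial_spreadP k Fam :
  reflect ((forall S, S \in Fam -> \dim S = k) /\
           (forall S T, S \in Fam -> T \in Fam -> S != T -> (S :&: T)%VS = 0%VS))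
          (partial_spread k Fam).
Proof.
apply: (iffP andP) => [[/forall_inP dimF /forall_inP disF] | [dimF disF]].
  split=> [S SF | S T SF TF nST]; first exact/eqP/dimF.
  by apply/eqP; move/forall_inP: (disF S SF) => /(_ T TF)/implyP; exact.
split; first by apply/forall_inP=> S /dimF/eqP.
apply/forall_inP=> S SF; apply/forall_inP=> T TF; apply/implyP=> nST.
by rewrite (disF S T).
Qed.

Lemma affine_meetsP u S T :
  reflect (exists2 v, v \in S & u + v \in T) (~~ [disjoint affine u S & T]).
Proof.
apply: (iffP pred0Pn) => [[_ /andP[/imsetP[v vS ->] uvT]] | [v vS uvT]].
  by exists v.
by exists (u + v); apply/andP; split=> //; apply/imsetP; exists v.
Qed.

Lemma AS_is_AAD k L Fam : (0 < k)%N -> is_AS k L.+1 Fam -> is_AAD k L Fam.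
Proof.
move=> k_gt0 /andP[spF /forallP meetF]; apply/andP; split=> //.
have /partial_spreadP[dimF disF] := spF.
apply/forall_inP=> S SF; apply/forallP=> u; apply/implyP=> nSu.
pose W := (S + <[u]>)%VS.
have dimW : \dim W = k.+1.
  have nz_u : u != 0 by apply: contraNneq nSu => ->; rewrite mem0v.
  rewrite dimv_disjoint_sum ?(dimF S) // ?dim_vline ?nz_u ?addn1 //.
  apply/eqP; rewrite -subv0; apply/subvP=> v /memv_capP[vS /vlineP[a va]].
  have [a0 | nz_a] := eqVneq a 0; first by rewrite va a0 scale0r mem0v.
  case/negP: nSu; rewrite -[u]scale1r -(mulVf nz_a) -scalerA -va.
  by rewrite memvZ.
rewrite -ltnS; apply: leq_trans (implyP (meetF W) _); last by rewrite dimW.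
(* The inclusion is strict because [S] itself meets [W] but not [u + S]; this gains the one in the
   bound. *)
apply: proper_card; apply/properP; split.
  apply/fintype.subsetP=> T; rewrite !inE => /andP[TF /affine_meetsP[v vS uvT]].
  rewrite TF; apply: contraNneq nSu => capWT.
  have : u + v \in (W :&: T)%VS.
    by rewrite memv_cap uvT addrC memv_add ?memv_line.
  by rewrite capWT memv0 addr_eq0 => /eqP->; rewrite memvN.
exists S; rewrite !inE SF /=.
  rewrite -dimv_eq0 (capv_idPr _) ?addvSl // dimF //; case: (k) k_gt0 => //.
by apply/affine_meetsP=> -[v vS]; rewrite rpredDr // (negPf nSu).
Qed.

Lemma leq_card_AAD k L Fam : (0 < k)%N -> (2 * k < n)%N ->
  is_AAD k L Fam -> (#|Fam| <= (2 * L + 1) * q ^ (n - 2 * k))%N.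
Proof.
move=> k_gt0 lt_kn /andP[/partial_spreadP[dimF disF] /forall_inP aadF].
have q_gt1 : (1 < q)%N := finNzRing_gt1 F.
have qn_gt0 i : (0 < q ^ i)%N by rewrite expn_gt0 ltnW.
have [-> | [S SF]] := set_0Vmem Fam; first by rewrite cards0.
have card_S : #|S| = (q ^ k)%N by rewrite (card_vspace (T := 'rV_n)) dimF.
(* Double count of the pairs [(T, u)] with [u] outside [S] and [T] meeting [u + S]. *)
have cnt : (#|Fam :\ S| * (q ^ (2 * k) - q ^ k) <= (q ^ n - q ^ k) * L)%N.
  have -> : (q ^ n - q ^ k)%N = #|[predC S]|.
    by rewrite -[n in LHS]mul1n -card_mx -(cardC (mem S)) card_S addKn.
  rewrite -!sum_nat_const.
  apply: (@leq_trans (\sum_(T in Fam :\ S) \sum_(u | u \notin S)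
                        ~~ [disjoint affine u S & T])).
    apply: leq_sum => T; rewrite in_setD1 => /andP[nTS TF].
    have dimST : \dim (S + T) = (2 * k)%N.
      rewrite dimv_disjoint_sum ?dimF // ?mul2n ?addnn //.
      by apply: disF; rewrite // eq_sym.
    rewrite -dimST -card_S -(card_vspace (T := 'rV_n)).
    have -> : #|(S + T)%VS| = (#|S| + #|[predD (S + T)%VS & S]|)%N.
      rewrite -(cardID (mem S) (S + T)%VS); congr (_ + _)%N.
      apply: eq_card => u; rewrite !inE andbC; apply/andb_idr => uS.
      by rewrite (subvP (addvSl S T)).
    rewrite addKn -sum1_card big_mkcond [leqRHS]big_mkcond; apply: leq_sum => u _.
    rewrite !inE; case: (boolP (u \in S)) => //= nSu.
    case: ifP => // /memv_addP[v vS [w wT uvw]].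
    suff -> : ~~ [disjoint affine u S & T] by [].
    by apply/affine_meetsP; exists (- v); rewrite ?memvN // uvw addrC addKr.
  rewrite exchange_big; apply: leq_sum => u nSu.
  have /forallP/(_ u)/implyP/(_ nSu) := aadF S SF; apply: leq_trans.
  rewrite -sum1_card [leqRHS]big_mkcond [leqLHS]big_mkcond; apply: leq_sum => T _.
  by rewrite !inE; case: (T == S) => //=; case: (T \in Fam) => //=; case: (~~ _).
have oF : #|Fam| = #|Fam :\ S|.+1 by rewrite (cardsD1 S) SF.
rewrite oF; move: cnt; set N := #|_ :\ _|.
have -> : (q ^ n = q ^ (n - 2 * k) * q ^ (2 * k))%N by rewrite -expnD subnK // ltnW.
have -> : (q ^ (2 * k) = q ^ k * q ^ k)%N by rewrite mul2n -addnn expnD.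
have : (1 < q ^ k)%N by rewrite (ltn_exp2l 0).
have := qn_gt0 (n - 2 * k)%N.
move: (q ^ k)%N (q ^ (n - 2 * k))%N => a b b_gt0 a_gt1 cnt.
(* With [a = q ^ k >= 2], passing from [a * a - a] to [a * a] costs the factor 2; the additional 1
   in [2 * L + 1] pays for [S] itself. *)
have le1 : (N * (a * a) <= 2 * (N * (a * a - a)))%N by nia.
have le2 : (N * (a * a) <= (2 * L * b) * (a * a))%N by nia.
have : (N <= 2 * L * b)%N by move: le2; rewrite leq_pmul2r //; nia.
nia.
Qed.

End Families.

(** * Families of graphs *)

Section Graphs.
Variables (F : finFieldType) (k l : nat).
Implicit Types (A : 'M[F]_(k, l)) (v : 'rV[F]_k) (w : 'rV[F]_l).
Local Notation q := #|F|.

Definition graph_sp A : {vspace 'rV[F]_(k + l)} :=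
  limg (linfun (mulmxr (row_mx 1%:M A))).

Lemma mem_graph A u : (u \in graph_sp A) = (rsubmx u == lsubmx u *m A).
Proof.
apply/memv_imgP/eqP => [[v _ ->] | uA].
  by rewrite lfunE /= mul_mx_row mulmx1 row_mxKl row_mxKr.
by exists (lsubmx u); rewrite ?memvf // lfunE /= mul_mx_row mulmx1 -uA hsubmxK.
Qed.

Lemma dim_graph A : \dim (graph_sp A) = k.
Proof.
rewrite limg_dim_eq ?dimvf /dim /= ?mul1n //; apply/eqP; rewrite -subv0.
apply/subvP=> v; rewrite memv_cap memvf memv_ker lfunE /= mul_mx_row mulmx1.
by rewrite memv0 => /eqP/(congr1 lsubmx); rewrite row_mxKl linear0 => ->.
Qed.

Variables (I : finType) (A : I -> 'M[F]_(k, l)).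

(** The differences [A x - A y] have trivial left kernel, which is the condition for two graphs to
    meet only in 0. *)
Definition transverse :=
  forall x y v, x != y -> v *m A x = v *m A y -> v = 0.

Lemma graph_inj : (0 < k)%N -> transverse -> injective (graph_sp \o A).
Proof.
move=> k_gt0 trA x y /= eqS; apply: contraTeq isT => nxy.
pose v : 'rV[F]_k := delta_mx 0 (Ordinal k_gt0).
have := mem_graph (A x) (row_mx v (v *m A x)).
rewrite eqS mem_graph row_mxKl row_mxKr eqxx => /eqP.
move/(trA _ _ _ nxy)/matrixP/(_ 0 (Ordinal k_gt0))/eqP.
by rewrite !mxE !eqxx oner_eq0.
Qed.

Lemma graph_spread (X : {set I}) : transverse ->
  partial_spread k [set graph_sp (A x) | x in X]%SET.
Proof.
move=> trA; apply/andP; split.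
  by apply/forall_inP=> _ /imsetP[x _ ->]; rewrite dim_graph.
apply/forall_inP=> _ /imsetP[x _ ->]; apply/forall_inP=> _ /imsetP[y _ ->].
apply/implyP=> nS; have nxy : x != y by apply: contraNneq nS => ->.
rewrite -subv0; apply/subvP=> u; rewrite memv_cap !mem_graph memv0.
case/andP=> /eqP ux /eqP uy; have u0 := trA x y _ nxy (etrans (esym ux) uy).
by rewrite -[u]hsubmxK ux u0 mul0mx row_mx0.
Qed.

(** Modulo the graph of [A x], every [u] is congruent to some [(0, w)], and [w] is nonzero exactly
    when [u] is off the graph; so only these translates need testing. *)
Lemma graph_AAD (X : {set I}) L : transverse ->
  (forall x w, x \in X -> w != 0 ->
    (#|[set y in X | [exists v, (v *m A y - v *m A x)%R == w]]%SET| <= L)%N) ->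
  is_AAD k L [set graph_sp (A x) | x in X]%SET.
Proof.
move=> trA bndA; apply/andP; split; first exact: graph_spread.
apply/forall_inP=> _ /imsetP[x xX ->]; apply/forallP=> u; apply/implyP.
rewrite mem_graph -subr_eq0 => nz_w; apply: leq_trans (bndA x _ xX nz_w).
apply: leq_trans (leq_imset_card (fun y => graph_sp (A y)) _).
apply/subset_leq_card/fintype.subsetP=> T; rewrite inE.
case/andP=> /imsetP[y yX ->] /pred0Pn[_ /andP[/imsetP[s sS ->]]].
rewrite inE !mem_graph in sS * => meet.
apply/imsetP; exists y => //; rewrite inE yX; apply/existsP.
(* The left block of the common point [u + s] is the required [v]. *)
exists (lsubmx (u + s)); rewrite -(eqP meet) !linearD /= (eqP sS) mulmxDl.
by rewrite opprD addrACA subrr addr0.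
Qed.

Lemma graph_AS (X : {set I}) L : (0 < k)%N -> transverse ->
  (forall W : {vspace 'rV[F]_(k + l)}, \dim W = k.+1 ->
    (#|[set y in X | (W :&: graph_sp (A y))%VS != 0%VS]%SET| <= L)%N) ->
  is_AS k L [set graph_sp (A x) | x in X]%SET.
Proof.
move=> k_gt0 trA bndA; apply/andP; split; first exact: graph_spread.
apply/forallP=> W; apply/implyP=> /eqP dimW; apply: leq_trans (bndA W dimW).
apply: leq_trans (leq_imset_card (fun y => graph_sp (A y)) _).
apply/subset_leq_card/fintype.subsetP=> T; rewrite inE.
case/andP=> /imsetP[y yX ->] meet; apply/imsetP; exists y => //.
by rewrite inE yX.
Qed.

(* Each member meets [W] in at least [q - 1] nonzero vectors, which are all distinct. *)
Lemma card_graph_meet (W : {vspace 'rV[F]_(k + l)}) : transverse ->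
  \dim W = k.+1 ->
  (#|[set y | (W :&: graph_sp (A y))%VS != 0%VS]%SET| <= 2 * q ^ k)%N.
Proof.
move=> trA dimW; set B := [set y | _]%SET.
have q_gt1 : (1 < q)%N := finNzRing_gt1 F.
pose g y := vpick (W :&: graph_sp (A y))%VS.
have gP y : y \in B -> g y != 0 by rewrite inE vpick0.
have gW y : g y \in W.
  by have := memv_pick (W :&: graph_sp (A y))%VS; rewrite memv_cap => /andP[].
have gS y : g y \in graph_sp (A y).
  by have := memv_pick (W :&: graph_sp (A y))%VS; rewrite memv_cap => /andP[].
pose h (p : I * F) := p.2 *: g p.1.
have inj_h : {in finset.setX B [set a : F | a != 0]%SET &, injective h}.
  move=> [x a] [y b]; rewrite !inE /= => /andP[xB nza] /andP[yB nzb].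
  rewrite /h /= => eqab.
  have [exy | nxy] := eqVneq x y.
    subst y; congr (_, _); apply/eqP; rewrite -subr_eq0.
    have /eqP := eqab; rewrite -subr_eq0 -scalerBl scaler_eq0.
    by rewrite (negPf (gP x _)) ?inE // orbF.
  have u_x := memvZ a (gS x); have := memvZ b (gS y); rewrite -eqab.
  move: u_x; set u := a *: g x; rewrite !mem_graph => /eqP ux /eqP uy.
  have u0 := trA x y _ nxy (etrans (esym ux) uy).
  have : u = 0 by rewrite -[u]hsubmxK ux u0 mul0mx row_mx0.
  by move/eqP; rewrite scaler_eq0 (negPf nza) (negPf (gP x _)) ?inE.
have le1 : (#|B| * (q - 1) <= q ^ k.+1)%N.
  have -> : (q - 1)%N = #|[set a : F | a != 0]%SET|.
    by rewrite subn1 -(cardC1 (0 : F)); apply: eq_card => a; rewrite !inE.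
  rewrite -cardsX -(card_in_imset inj_h) -dimW -(card_vspace (T := 'rV_(k + l))).
  apply/subset_leq_card/fintype.subsetP=> _ /imsetP[p _ ->].
  exact: memvZ.
move: le1; rewrite expnS; move: #|B| (q ^ k)%N => b c; nia.
Qed.

End Graphs.

(** * Counting subspaces of a given dimension *)

Lemma vspace_row_basis (F : finFieldType) n (W : {vspace 'rV[F]_n}) :
  exists M : 'M[F]_(\dim W, n),
    (forall u, u \in W <-> exists v, u = v *m M) /\ injective (mulmxr M : 'rV_ _ -> _).
Proof.
pose M := \matrix_(i < \dim W) (vbasis W)`_i.
have ME (v : 'rV_(\dim W)) : v *m M = \sum_i v 0 i *: (vbasis W)`_i.
  by rewrite mulmx_sum_row; apply: eq_bigr => i _; rewrite rowK.
exists M; split=> [u | v1 v2 /=].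
  split=> [uW | [v ->]]; last first.
    by rewrite ME memv_suml // => i _; rewrite memvZ // vbasis_mem ?memt_nth.
  exists (\row_i coord (vbasis W) i u); rewrite ME {1}(coord_vbasis uW).
  by apply: eq_bigr => i _; rewrite mxE.
have freeW : free (vbasis W) := basis_free (vbasisP W).
rewrite !ME => eqv; apply/rowP=> i.
by rewrite -(coord_sum_free (v1 0) i freeW) eqv coord_sum_free.
Qed.

(** The order is [q ^ 'C(j.+1, 2)] times the product of the [q ^ i - 1] for [1 <= i <= j + 1], and
    each such factor is at least [q ^ (i - 1)]. *)
Lemma leq_card_GL (F : finFieldType) j :
  (#|F| ^ (j.+1 * j) <= #|('GL_j.+1[F])%g|)%N.
Proof.
have q_gt1 : (1 < #|F|)%N := finNzRing_gt1 F.
have := bin_ffact j.+1 2; rewrite ffactnS ffactn1 /= => <-.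
rewrite card_GL // muln2 -addnn expnD leq_mul2l; apply/orP; right.
rewrite big_add1 -bin2_sum expn_sum /=; apply: leq_prod => i _.
have : (0 < #|F| ^ i)%N by rewrite expn_gt0 ltnW.
by rewrite expnS; move: (#|F| ^ i)%N #|F| q_gt1 => c b; nia.
Qed.

(* [GL_j] acts freely on the ordered bases of each subspace. *)
Lemma leq_card_subspaces (F : finFieldType) n j :
  (#|[set W : {vspace 'rV[F]_n} | \dim W == j.+1]%SET| * #|F| ^ (j.+1 * j)
     <= #|F| ^ (j.+1 * n))%N.
Proof.
apply: leq_trans (leq_mul (leqnn _) (leq_card_GL F j)) _.
rewrite -card_mx -cardsX.
have ex_M (W : {vspace 'rV[F]_n}) : exists M : 'M[F]_(j.+1, n), \dim W = j.+1 ->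
    (forall u, u \in W <-> exists v, u = v *m M) /\
    injective (mulmxr M : 'rV_ _ -> _).
  have [dimW | ndimW] := eqVneq (\dim W) j.+1; last by exists 0 => /eqP/idPn.
  have [M PM] := vspace_row_basis W; exists (castmx (dimW, erefl n) M).
  by case: _ / dimW.
pose M W := projT1 (cid (ex_M W)).
have MP W : \dim W = j.+1 -> _ := projT2 (cid (ex_M W)).
pose h (p : {vspace 'rV[F]_n} * {'GL_j.+1[F]}) := GLval p.2 *m M p.1.
rewrite -(card_in_imset (f := h)) ?max_card //.
move=> [W g] [W' g']; rewrite !inE /h /= => /andP[/eqP dW _] /andP[/eqP dW' _] eqh.
have [memW injW] := MP W dW; have [memW' injW'] := MP W' dW'.
(* An invertible left factor keeps the row space, so the product determines [W]; the independent
   rows of [M W] then determine [g]. *)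
have row_sp (U : {vspace 'rV[F]_n}) (s : {'GL_j.+1[F]}) : \dim U = j.+1 ->
    forall u, u \in U <-> exists v, u = v *m (GLval s *m M U).
  move=> dU u; have [-> _] := MP U dU; split=> [[v ->] | [v ->]].
    exists (v *m invmx (GLval s)).
    by rewrite mulmxA mulmxKV //; exact: (GL_unitmx s).
  by exists (v *m GLval s); rewrite mulmxA.
have eqW : W = W'.
  apply/vspaceP=> u; apply/idP/idP => [/(row_sp _ g dW) | /(row_sp _ g' dW')].
    by rewrite eqh; move/(row_sp _ g' dW').
  by rewrite -eqh; move/(row_sp _ g dW).
rewrite -eqW in eqh *; congr (_, _); apply/val_inj/row_matrixP => i /=.
by apply: injW; rewrite /= -!row_mul eqh.
Qed.

(** * Finite extensions, norm and trace *)

Lemma pchar_nat_card (F : finFieldType) j : [pchar F].-nat (#|F| ^ j)%N.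
Proof.
have [p p_pr pF] := finPcharP F.
rewrite (card_pprimeChar pF) -expnM pnatX; apply/orP; left.
by rewrite (eq_pnat _ (pcharf_eq pF)) pnat_id.
Qed.

(* The argument of [pPrimePowerField], over [F] instead of ['F_p]. *)
Lemma finField_extension (F : finFieldType) (m : nat) : (0 < m)%N ->
  exists L : splittingFieldType F, \dim {: L} = m.
Proof.
move=> m_gt0; set q := #|F|; set Q := (q ^ m)%N.
have q_gt1 : (1 < q)%N := finNzRing_gt1 F.
have Q_gt1 : (1 < Q)%N by rewrite (ltn_exp2l 0).
have Q_gt0 := ltnW Q_gt1.
have Q1_gt0 : (0 < Q.-1)%N by rewrite -ltnS prednK.
pose P (R : nzRingType) : {poly R} := 'X^Q - 'X.
have defP (R : nzRingType) : P R = ('X^(Q.-1) - 1) * ('X - 0%:P).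
  by rewrite subr0 mulrBl mul1r -exprSr prednK.
have /FinSplittingFieldFor[/= L splitL] : P F != 0.
  by rewrite defP monic_neq0 ?rpredM ?monicXsubC ?monicXnsubC.
rewrite rmorphB rmorphXn /= map_polyX -/(P L) in splitL.
have [p p_pr pF] := finPcharP F.
have pL : p \in [pchar L] by rewrite pchar_lalg.
exists L.
have /finField_galois_generator[/= a _ Da] : (1 <= {:L})%VS by apply: sub1v.
rewrite dimv1 expn1 -/q in Da.
(* The generator [a] is [x |-> x ^+ q], so the fixed field of [a ^+ m] is the set of roots of
   ['X^Q - 'X]. These roots generate [L], hence exhaust it. *)
pose Em := fixedSpace (a ^+ m)%g.
have [zs DPL defL] := splitL.
have Q0 : Q%:R = 0 :> L.
  have [e qE] : exists e, q = (p ^ e)%N by eexists; apply: card_pprimeChar pF.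
  apply/eqP; rewrite -(dvdn_pcharf pL) /Q qE -expnM dvdn_exp // lt0n.
  by apply: contraTneq Q_gt1 => e0; rewrite /Q qE -expnM e0.
(* As [Q] vanishes in [L], [Q - 1] is a unit there and ['X^(Q.-1) - 1] is separable, so there are
   exactly [Q] roots. *)
have Uzs : uniq zs.
  rewrite -separable_prod_XsubC -(eqp_separable DPL) defP separable_root andbC.
  rewrite /root !hornerE subr_eq0 eq_sym expr0n gtn_eqF ?oner_eq0 //=.
  rewrite cyclotomic.separable_Xn_sub_1 // -subn1 natrB // subr_eq0.
  by rewrite Q0 eq_sym oner_eq0.
have in_zs : zs =i Em.
  move=> z; rewrite -root_prod_XsubC -(eqp_root DPL) (sameP fixedSpaceP eqP).
  rewrite /root !hornerE subr_eq0 /= /Q; congr (_ == z).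
  elim: (m) => [|i IHi]; first by rewrite gal_id.
  by rewrite expgSr expnSr exprM IHi galM ?Da ?memvf.
have defEm : Em = {:L}%VS.
  apply/eqP; rewrite eqEsubv subvf -defL -[Em]subfield_closed agenvS //.
  by rewrite subv_add sub1v; apply/span_subvP=> z; rewrite in_zs.
pose Lf := FinFieldExtType L.
have cardL : #|Lf| = Q.
  have /eq_card-> : Lf =i zs by move=> z; rewrite in_zs defEm memvf.
  apply: succn_inj; rewrite (card_uniqP _) //= -(size_prod_XsubC _ id).
  by rewrite -(eqp_size DPL) size_polyDl size_polyXn // size_polyN size_polyX.
apply/eqP; rewrite -(eqn_exp2l _ _ q_gt1) -/Q -cardL /q.
by rewrite -(card_vspace (T := Lf)) card_vspacef.
Qed.

(** A generator of the multiplicative group works: for [m > 1] the exponents [q ^ j] are distinct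
    and below its order [q ^ m - 1]; otherwise there is at most one index. *)
Lemma primitive_element_conj_inj (E : finFieldType) q m :
  (1 < q)%N -> #|E| = (q ^ m)%N ->
  exists th : E, injective (fun j : 'I_m => th ^+ (q ^ j)%N).
Proof.
move=> q_gt1 oE; have E_gt1 := finNzRing_gt1 E.
have n_gt0 : (0 < #|E|.-1)%N by rewrite -ltnS prednK // ltnW.
have /hasP[z _ z_prim] : has #|E|.-1.-primitive_root (enum (predC1 (0 : E))).
  apply: has_prim_root => //; last by rewrite -cardE cardC1.
    apply/allP=> x; rewrite mem_enum unity_rootE => /= nx0.
    apply/eqP/(mulfI nx0); rewrite -exprS prednK ?mulr1 ?expf_card //.
    exact: ltnW.
  exact: enum_uniq.
have lt_m k : (k < m)%N -> (1 < m)%N -> (q ^ k < #|E|.-1)%N.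
  rewrite oE; case: (m) => // m' le_km m'_gt0.
  have le_k : (q ^ k <= q ^ m')%N by rewrite leq_exp2l // -ltnS.
  have : (1 < q ^ m')%N by rewrite (ltn_exp2l 0).
  rewrite expnS; move: q_gt1 le_k; nia.
exists z => i j /eqP; rewrite (eq_prim_root_expr z_prim).
have [m_gt1 | m_le1] := ltnP 1 m.
  by rewrite !modn_small ?lt_m // eqn_exp2l // => /eqP/val_inj.
by move=> _; apply/val_inj; move: (ltn_ord i) (ltn_ord j) m_le1 => /=; lia.
Qed.

Section NormTrace.
Variables (F E : finFieldType) (f : {rmorphism F -> E}) (m : nat).
Hypothesis oE : #|E| = (#|F| ^ m)%N.
Local Notation q := #|F|.

(** Norm and trace of [E] over [F], written through Frobenius conjugates and taking values in [E];
    their descent to [F] rests on invariance under the [q]-th power. *)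
Definition conj_norm (x : E) := \prod_(j < m) x ^+ (q ^ j)%N.
Definition conj_trace (x : E) := \sum_(j < m) x ^+ (q ^ j)%N.

Lemma pchar_nat_ext j : [pchar E].-nat (q ^ j)%N.
Proof.
have [p p_pr pF] := finPcharP F.
have pE : p \in [pchar E] by exact: rmorph_pchar pF.
by rewrite (eq_pnat _ (pcharf_eq pE)) -(eq_pnat _ (pcharf_eq pF)) pchar_nat_card.
Qed.

Lemma frobD j : {morph (fun x : E => x ^+ (q ^ j)%N) : x y / x + y}.
Proof. by move=> x y; rewrite (exprDn_pchar _ _ (pchar_nat_ext j)). Qed.

Lemma frob_base j a : f a ^+ (q ^ j)%N = f a.
Proof.
rewrite -rmorphXn; congr (f _).
by elim: j => [|j IHj]; rewrite ?expr1 // expnSr exprM IHj expf_card.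
Qed.

(** The [q]-th power permutes the conjugates cyclically, because [x ^+ (q ^ m) = x]. The abstract
    [op] serves both norm and trace. *)
Lemma frob_rotate idx (op : Monoid.com_law idx) (x : E) :
  \big[op/idx]_(j < m) (x ^+ (q ^ j)%N) ^+ q =
  \big[op/idx]_(j < m) x ^+ (q ^ j)%N.
Proof.
have xE : x ^+ (q ^ m)%N = x by rewrite -oE expf_card.
under eq_bigr do rewrite -exprM -expnSr.
case: (m) xE => [|m'] xE; first by rewrite !big_ord0.
by rewrite big_ord_recr big_ord_recl /= xE expr1 Monoid.mulmC.
Qed.

Lemma conj_norm_frob x : conj_norm x ^+ q = conj_norm x.
Proof. by rewrite /conj_norm -prodrXl; exact: frob_rotate. Qed.

Lemma conj_trace_frob x : conj_trace x ^+ q = conj_trace x.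
Proof.
transitivity (\sum_(j < m) (x ^+ (q ^ j)%N) ^+ q); last exact: frob_rotate.
apply: (big_morph (fun y : E => y ^+ q)) => [y z|].
  by have := frobD 1 y z; rewrite expn1.
by rewrite expr0n eqn0Ngt (ltnW (finNzRing_gt1 F)).
Qed.

Lemma conj_traceD : {morph conj_trace : x y / x + y}.
Proof.
by move=> x y; rewrite /conj_trace -big_split; apply: eq_bigr => j _; apply: frobD.
Qed.

Lemma conj_traceZ a x : conj_trace (f a * x) = f a * conj_trace x.
Proof.
rewrite /conj_trace mulr_sumr; apply: eq_bigr => j _.
by rewrite exprMn frob_base.
Qed.

(** Scalars from [F] are fixed by Frobenius, so each conjugate of [x + f t * w] is linear in [f t]
    with leading coefficient a conjugate of [w]; the product has degree exactly [m]. *)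
Lemma card_conj_norm_line (x w c : E) : (0 < m)%N -> w != 0 ->
  (#|[set t : F | conj_norm (x + f t * w)%R == c]%SET| <= m)%N.
Proof.
move=> m_gt0 nz_w.
pose P : {poly E} :=
  \prod_(j < m) ((w ^+ (q ^ j)%N) *: 'X + (x ^+ (q ^ j)%N)%:P).
have szP : size P = m.+1.
  rewrite size_prod => [|j _]; last first.
    by rewrite -size_poly_eq0 size_polyDl size_scale ?expf_neq0 // size_polyX
               // (leq_ltn_trans (size_polyC_leq1 _)).
  rewrite (eq_bigr (fun=> 2)) => [|j _]; last first.
    by rewrite size_polyDl size_scale ?expf_neq0 // size_polyX
               // (leq_ltn_trans (size_polyC_leq1 _)).
  by rewrite sum_nat_const card_ord; lia.
have szPc : size (P - c%:P) = m.+1.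
  by rewrite size_polyDl // szP size_polyN (leq_ltn_trans (size_polyC_leq1 _)).
rewrite -ltnS -szPc cardE -(size_map f); apply: max_poly_roots.
- by rewrite -size_poly_eq0 szPc.
- apply/allP=> _ /mapP[t + ->]; rewrite mem_enum inE => /eqP Nt.
  rewrite rootE !hornerE subr_eq0 -Nt horner_prod; apply/eqP/eq_bigr => j _.
  by rewrite !hornerE frobD exprMn frob_base addrC mulrC.
- by rewrite map_inj_uniq ?enum_uniq //; apply: fmorph_inj.
Qed.

(* Clearing denominators gives a polynomial in [f b] of degree at most [m], nonzero
   because at [- th ^+ q ^ i] only the [i]-th summand of the trace survives. *)
Lemma card_conj_trace_inv (th w c : E) :
  injective (fun j : 'I_m => th ^+ (q ^ j)%N) ->
  (0 < m)%N -> w != 0 -> (forall b, f b + th != 0) ->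
  (#|[set b : F | conj_trace (w / (f b + th))%R == c]%SET| <= m)%N.
Proof.
move=> inj_th m_gt0 nz_w nz_den.
pose T (j : 'I_m) := th ^+ (q ^ j)%N; pose W (j : 'I_m) := w ^+ (q ^ j)%N.
pose P : {poly E} :=
  \sum_(i < m) (W i) *: \prod_(j < m | j != i) ('X + (T j)%:P)
  - c *: \prod_(j < m) ('X + (T j)%:P).
have szX (j : 'I_m) : size ('X + (T j)%:P) = 2%N by rewrite size_XaddC.
have nzX (j : 'I_m) : 'X + (T j)%:P != 0 by rewrite -size_poly_eq0 szX.
have szQ (A : pred 'I_m) : (size (\prod_(j < m | A j) ('X + (T j)%:P))%R <= m.+1)%N.
  rewrite size_prod // (eq_bigr (fun=> 2%N)) // sum_nat_const.
  have := max_card A; rewrite card_ord; set k := #|_|; move=> le_km.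
  by lia.
have szP : (size P <= m.+1)%N.
  rewrite (leq_trans (size_polyD _ _)) // geq_max size_polyN.
  rewrite (leq_trans (size_scale_leq _ _)) // andbT.
  apply: leq_trans (size_sum _ _ _) _; apply/bigmax_leqP => i _.
  exact: leq_trans (size_scale_leq _ _) _.
pose i0 : 'I_m := Ordinal m_gt0.
have hornerT (A : pred 'I_m) y :
    (\prod_(j < m | A j) ('X + (T j)%:P)).[y] = \prod_(j < m | A j) (y + T j).
  by rewrite horner_prod; apply: eq_bigr => j _; rewrite !hornerE.
have root_i0 (A : pred 'I_m) : A i0 -> \prod_(j < m | A j) (- T i0 + T j) = 0.
  by move=> Ai0; rewrite (bigD1 i0) //= addNr mul0r.
have Pi0 : P.[- T i0] = W i0 * \prod_(j < m | j != i0) (- T i0 + T j).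
  rewrite /P hornerD hornerN hornerZ horner_sum hornerT.
  rewrite (root_i0 predT) // mulr0 subr0.
  rewrite (bigD1 i0) //= hornerZ hornerT [X in _ + X]big1 ?addr0 // => i ni.
  by rewrite hornerZ hornerT root_i0 ?mulr0 // eq_sym.
have nzP : P != 0.
  apply: contraNneq (expf_neq0 (q ^ i0) nz_w) => P0; move: Pi0.
  rewrite P0 horner0 => /esym/eqP; rewrite mulf_eq0 => /orP[//|].
  case/prodf_eq0=> j nj; rewrite addrC subr_eq0 => /eqP/inj_th ji.
  by rewrite ji eqxx in nj.
rewrite -ltnS; apply: leq_trans _ szP; rewrite cardE -(size_map f).
apply: max_poly_roots => //; last first.
  by rewrite map_inj_uniq ?enum_uniq //; apply: fmorph_inj.
apply/allP=> _ /mapP[b + ->]; rewrite mem_enum inE => /eqP Tb.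
have den j : (f b + th) ^+ (q ^ j)%N = f b + th ^+ (q ^ j)%N.
  by rewrite frobD frob_base.
have hornerTb (A : pred 'I_m) :
    \prod_(j < m | A j) (f b + T j) = \prod_(j < m | A j) (f b + th) ^+ (q ^ j)%N.
  by apply: eq_bigr => j _; rewrite den.
rewrite rootE hornerD hornerN hornerZ horner_sum hornerT subr_eq0 -Tb.
rewrite mulr_suml; apply/eqP/eq_bigr => i _.
rewrite hornerZ hornerT !hornerTb [in RHS](bigD1 i) //= mulrA exprMn exprVn.
by rewrite mulfVK // expf_neq0.
Qed.

End NormTrace.

(** * Constructions *)

(** Data for the constructions: [c] identifies [E] with row vectors over [F], Frobenius-fixed
    elements descend to [F], and [th] has [m] distinct conjugates. *)
Lemma finField_extension_coord (F : finFieldType) m : (0 < m)%N ->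
  exists (E : finFieldType) (f : {rmorphism F -> E}) (c : E -> 'rV[F]_m) (th : E),
    [/\ #|E| = (#|F| ^ m)%N,
        injective c,
        forall a x y, c (f a * x + y) = a *: c x + c y,
        forall x, x ^+ #|F| = x -> exists a, f a = x
      & injective (fun j : 'I_m => th ^+ (#|F| ^ j)%N)].
Proof.
move=> m_gt0; have [L dimL] := finField_extension F m_gt0.
pose E : finFieldType := FinFieldExtType L.
have oE : #|E| = (#|F| ^ m)%N.
  by rewrite -dimL -(card_vspace (T := E)) card_vspacef.
have [th inj_th] := primitive_element_conj_inj (finNzRing_gt1 F) oE.
have [c inj_c lin_c] : exists2 c : L -> 'rV[F]_m, injective c &
    forall a x y, c (a *: x + y) = a *: c x + c y.
  rewrite -dimL; exists (fun x => \row_i coord (vbasis {:L}) i x) => [x y eqc|].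
    rewrite (coord_vbasis (memvf x)) (coord_vbasis (memvf y)).
    by apply: eq_bigr => i _; move/rowP/(_ i): eqc; rewrite !mxE => ->.
  by move=> a x y; apply/rowP=> i; rewrite !mxE linearP.
exists E, (in_alg L), c, th; split=> //.
  by move=> a x y; rewrite /= -lin_c -[a *: x]mulr_algl.
move=> x xq; have := Fermat's_little_theorem (1%AS : {subfield L}) x.
rewrite dimv1 expn1 xq eqxx => /vlineP[a ->].
by exists a.
Qed.

Lemma sub_AAD (F : finFieldType) n k L L' (Fam : {set {vspace 'rV[F]_n}}) :
  (L <= L')%N -> is_AAD k L Fam -> is_AAD k L' Fam.
Proof.
move=> leL /andP[sp /forall_inP aad]; apply/andP; split=> //.
apply/forall_inP=> S SF; apply/forallP=> u; apply/implyP=> nSu.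
by apply: leq_trans leL; move/forallP: (aad S SF) => /(_ u)/implyP; exact.
Qed.

Lemma sub_AS (F : finFieldType) n k L L' (Fam : {set {vspace 'rV[F]_n}}) :
  (L <= L')%N -> is_AS k L Fam -> is_AS k L' Fam.
Proof.
move=> leL /andP[sp /forallP as_]; apply/andP; split=> //.
by apply/forallP=> W; apply/implyP=> dW; apply: leq_trans leL; exact: implyP dW.
Qed.

(** A line meeting the plane [W] lies in it. With one such member [S] and [u] in [W] off [S], every
    other member inside [W] crosses [u + S]; adding [S] gives [L + 1]. *)
Lemma AAD1_is_AS (F : finFieldType) n L (Fam : {set {vspace 'rV[F]_n}}) :
  is_AAD 1 L Fam -> is_AS 1 L.+1 Fam.
Proof.
move=> /andP[spF /forall_inP aadF]; apply/andP; split=> //.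
have /partial_spreadP[dimF disF] := spF.
apply/forallP=> W; apply/implyP=> /eqP dimW; set B := [set T in Fam | _]%SET.
have subW T : T \in B -> (T <= W)%VS.
  rewrite inE => /andP[TF]; rewrite -dimv_eq0 -lt0n => dimWT.
  by apply/capv_idPr/eqP; rewrite eqEdim capvSr dimF.
have [-> | [S SB]] := set_0Vmem B; first by rewrite cards0.
have SF : S \in Fam by move: SB; rewrite inE => /andP[].
have /subvPn[u uW nSu] : ~~ (W <= S)%VS.
  by apply/negP=> /dimvS; rewrite dimW dimF.
have defW : (S + <[u]>)%VS = W.
  have nz_u : u != 0 by apply: contraNneq nSu => ->; rewrite mem0v.
  apply/eqP; rewrite eqEdim subv_add subW //= -memvE uW dimW.
  rewrite dimv_disjoint_sum ?(dimF S) ?dim_vline ?nz_u //.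
  apply/eqP; rewrite -subv0; apply/subvP=> v /memv_capP[vS /vlineP[a va]].
  have [a0 | nz_a] := eqVneq a 0; first by rewrite va a0 scale0r mem0v.
  case/negP: nSu; rewrite -[u]scale1r -(mulVf nz_a) -scalerA -va.
  by rewrite memvZ.
rewrite (cardsD1 S) SB add1n ltnS.
have /forallP/(_ u)/implyP/(_ nSu) := aadF S SF; apply: leq_trans.
apply/subset_leq_card/fintype.subsetP=> T; rewrite in_setD1 => /andP[nTS TB].
have TF : T \in Fam by move: TB; rewrite inE => /andP[].
rewrite inE TF /=; have nT0 : T != 0%VS by rewrite -dimv_eq0 dimF.
have := memv_pick T; set t := vpick T => tT.
have /memv_addP[s sS [_ /vlineP[a ->] tE]] : t \in (S + <[u]>)%VS.
  by rewrite defW (subvP (subW T TB)).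
(* Otherwise [t] would be a nonzero common vector of [S] and [T]; dividing by [a] then moves [t]
   into [u + S]. *)
have nz_a : a != 0.
  apply: contraNneq nT0 => a0; rewrite -vpick0 -memv0 -(disF T S) // memv_cap tT.
  by rewrite -/t tE a0 scale0r addr0.
apply/affine_meetsP; exists (a^-1 *: s); first by rewrite memvZ.
by rewrite -[u]scale1r -(mulVf nz_a) -scalerA -scalerDr addrC -tE memvZ.
Qed.

Section Constructions.
Variables (F E : finFieldType) (f : {rmorphism F -> E}) (m : nat).
Variables (c : E -> 'rV[F]_m) (th : E).
Local Notation q := #|F|.
Hypotheses (m_gt0 : (0 < m)%N) (oE : #|E| = (q ^ m)%N) (inj_c : injective c).
Hypothesis lin_c : forall a x y, c (f a * x + y) = a *: c x + c y.
Hypothesis fixed_base : forall x, x ^+ q = x -> exists a, f a = x.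
Hypothesis inj_th : injective (fun j : 'I_m => th ^+ (q ^ j)%N).

Local Notation N := (@conj_norm F E m).
Local Notation Tr := (@conj_trace F E m).

Lemma coord0 : c 0 = 0.
Proof. by have := lin_c (-1) 0 0; rewrite mulr0 addr0 scaleN1r addNr. Qed.

Lemma coordZ a x : c (f a * x) = a *: c x.
Proof. by have := lin_c a x 0; rewrite coord0 !addr0. Qed.

Lemma coordD : {morph c : x y / x + y}.
Proof. by move=> x y; have := lin_c 1 x y; rewrite rmorph1 mul1r scale1r. Qed.

Lemma coordB x y : c (x - y) = c x - c y.
Proof.
by have := lin_c (-1) y x; rewrite rmorphN1 mulN1r scaleN1r addrC => ->; rewrite addrC.
Qed.

Section Embedding.
Variable k : nat.

(** Maps row vectors onto the span of [1, th, ..., th ^+ (k - 1)], so that a difference of two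
    member maps becomes multiplication by [x - y] in a field. *)
Definition poly_embed (v : 'rV[F]_k) : E := \sum_(i < k) f (v 0 i) * th ^+ i.

Definition mul_mx (x : E) : 'M[F]_(k, m) := \matrix_(i < k) c (th ^+ i * x).

Lemma mul_mxE v x : v *m mul_mx x = c (poly_embed v * x).
Proof.
rewrite mulmx_sum_row mulr_suml (big_morph c coordD coord0).
by apply: eq_bigr => i _; rewrite rowK -mulrA coordZ.
Qed.

(* The polynomial of degree less than [k] defining [v] also vanishes at the [m]
   conjugates of [th]. *)
Lemma poly_embed_eq0 v : (k <= m)%N -> poly_embed v = 0 -> v = 0.
Proof.
move=> le_km v0; pose p : {poly E} := \sum_(i < k) f (v 0 i) *: 'X^i.
have coef_p (i : 'I_k) : p`_i = f (v 0 i).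
  rewrite coef_sum (bigD1 i) //= big1 ?addr0 => [|j nj].
    by rewrite coefZ coefXn eqxx mulr1.
  by rewrite coefZ coefXn eq_sym (negPf (_ : j != i :> nat)) ?mulr0.
have root_p (j : 'I_m) : root p (th ^+ (q ^ j)%N).
  rewrite rootE horner_sum; apply/eqP; transitivity (poly_embed v ^+ (q ^ j)%N).
    rewrite /poly_embed (big_morph _ (frobD f j) (_ : _ = 0)); last first.
      by rewrite expr0n expn_eq0 eqn0Ngt (ltnW (finNzRing_gt1 F)).
    apply: eq_bigr => i _.
    by rewrite !hornerE exprMn frob_base -!exprM mulnC.
  by rewrite v0 expr0n expn_eq0 eqn0Ngt (ltnW (finNzRing_gt1 F)).
have szp : (size p <= m)%N.
  apply: leq_trans (size_sum _ _ _) _; apply/bigmax_leqP => i _.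
  rewrite (leq_trans (size_scale_leq _ _)) // size_polyXn.
  exact: leq_trans (ltn_ord i) le_km.
have [p0 | nz_p] := eqVneq p 0.
  apply/rowP=> i; rewrite mxE; apply/(fmorph_inj f).
  by rewrite -coef_p p0 coef0 rmorph0.
have rootsP : all (root p) [seq th ^+ (q ^ j)%N | j : 'I_m].
  by apply/allP=> _ /mapP[j _ ->].
have uniqP : uniq [seq th ^+ (q ^ j)%N | j : 'I_m].
  by rewrite map_inj_uniq ?enum_uniq.
have := max_poly_roots nz_p rootsP uniqP.
by rewrite size_image card_ord ltnNge szp.
Qed.

Lemma mul_mx_transverse : (k <= m)%N -> transverse mul_mx.
Proof.
move=> le_km x y v nxy; rewrite !mul_mxE => /inj_c/eqP.
rewrite -subr_eq0 -mulrBr mulf_eq0 subr_eq0 (negPf nxy) orbF => /eqP.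
exact: poly_embed_eq0.
Qed.

End Embedding.

(** Pigeonhole: the norm sends [q ^ m] elements to at most [q] values, those of [F]. *)
Lemma popular_norm : exists z, (q ^ m.-1 <= #|[set x | N x == z]%SET|)%N.
Proof.
apply/existsP; apply/contraT; rewrite negb_exists => /forallP lt_q.
have q_gt1 : (1 < q)%N := finNzRing_gt1 F.
suff : (#|E| < q * q ^ m.-1)%N by rewrite -expnS prednK // oE ltnn.
have -> : #|E| = (\sum_(a : F) #|[set x | N x == f a]%SET|)%N.
  rewrite -sum1_card (eq_bigr (fun x => \sum_(a : F) (N x == f a))%N) => [|x _].
    rewrite exchange_big; apply: eq_bigr => a _.
    by rewrite -sum1_card [RHS]big_mkcond; apply: eq_bigr => x _; rewrite inE.
  have [a fa] := fixed_base (conj_norm_frob oE x).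
  rewrite (bigD1 a) //= fa eqxx big1 // => b nb.
  by rewrite -fa (inj_eq (fmorph_inj f)) eq_sym (negPf nb).
rewrite -sum_nat_const (bigD1 0) //= [X in (_ < X)%N](bigD1 0) //= -addSn.
rewrite leq_add // ?ltnNge; first exact: lt_q.
by apply: leq_sum => a _; apply: ltnW; rewrite ltnNge lt_q.
Qed.

Lemma card_norm_line (x w z : E) (X : {set E}) : w != 0 ->
  {in X, forall y, N y = z /\ exists t, y = x + f t * w} ->
  (#|X| <= m)%N.
Proof.
move=> nz_w XP; apply: leq_trans (card_conj_norm_line f oE x z m_gt0 nz_w).
apply: leq_trans (leq_imset_card (fun t => x + f t * w) _).
apply/subset_leq_card/fintype.subsetP=> y /XP[Ny [t yE]].
by apply/imsetP; exists t; rewrite // inE -yE Ny.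
Qed.

Lemma exists_AS_random k L M : (0 < k)%N -> (k <= m)%N -> (M <= q ^ m)%N ->
  (q ^ (k.+1 * m) * (2 * q ^ k * M) ^ L.+1 < q ^ (m * L.+1))%N ->
  exists2 Fam : {set {vspace 'rV[F]_(k + m)}}, is_AS k L Fam & #|Fam| = M.
Proof.
move=> k_gt0 le_km leM lt_q; have trA := mul_mx_transverse le_km.
have q_gt1 : (1 < q)%N := finNzRing_gt1 F.
pose B (W : {vspace 'rV[F]_(k + m)}) :=
  [set y | (W :&: graph_sp (mul_mx k y))%VS != 0%VS]%SET.
pose P := [pred W : {vspace 'rV[F]_(k + m)} | \dim W == k.+1].
(* The order of the linear group cancels [q ^ (k.+1 * k)] from [q ^ (k.+1 * (k + m))]. *)
have cardP : (#|P| <= q ^ (k.+1 * m))%N.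
  have := leq_card_subspaces F (k + m) k; rewrite mulnDr expnD mulnC.
  rewrite leq_pmul2l ?expn_gt0 ?(ltnW q_gt1) //; apply: leq_trans.
  by rewrite cardsE.
have [W /eqP dW | | | A [oA AP]] :=
  @exists_sparse_subset _ _ P B (2 * q ^ k) M L _ _ _.
- exact: card_graph_meet.
- by rewrite oE.
- rewrite oE -expnM; apply: leq_ltn_trans lt_q.
  by rewrite leq_mul2r cardP orbT.
exists [set graph_sp (mul_mx k x) | x in A]%SET; last first.
  by rewrite card_imset //; exact: graph_inj.
apply: graph_AS => // W dW; apply: leq_trans (AP W _); last exact/eqP.
by apply/subset_leq_card/fintype.subsetP=> y; rewrite !inE.
Qed.

Lemma exists_AAD1 : exists2 Fam : {set {vspace 'rV[F]_(1 + m)}},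
  is_AAD 1 m Fam & (q ^ m.-1 <= #|Fam|)%N.
Proof.
have [z leX] := popular_norm; set X := finset _ in leX.
have trA := mul_mx_transverse m_gt0.
exists [set graph_sp (mul_mx 1 x) | x in X]%SET; last first.
  by rewrite card_imset //; exact: graph_inj.
apply: graph_AAD => // x w xX nz_w; set Y := [set y in X | _]%SET.
have embedE (v : 'rV[F]_1) : poly_embed v = f (v 0 0).
  by rewrite /poly_embed big_ord1 mulr1.
have YP y : y \in Y -> N y = z /\ exists2 a, a != 0 & c (f a * (y - x)) = w.
  rewrite !inE => /andP[/eqP Ny /existsP[v /eqP vw]]; split=> //.
  have vE : c (f (v 0 0) * (y - x)) = w.
    by rewrite -vw !mul_mxE -coordB -mulrBr embedE.
  exists (v 0 0) => //; apply: contraNneq nz_w => v0.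
  by rewrite -vE v0 rmorph0 mul0r coord0.
have [-> | [y0 /YP[_ [a0 nz_a0 w_y0]]]] := set_0Vmem Y; first by rewrite cards0.
(* All solutions represent the same [w], so they lie on the line through [x] in the direction given
   by one solution [y0]. *)
apply: (@card_norm_line x (f a0 * (y0 - x)) z).
  by apply: contraNneq nz_w => w0; rewrite -w_y0 w0 coord0.
move=> y /YP[Ny [a nz_a w_y]]; split=> //; exists a^-1.
have -> : f a0 * (y0 - x) = f a * (y - x) by apply: inj_c; rewrite w_y w_y0.
by rewrite mulrA -rmorphM mulVf // rmorph1 mul1r subrKC.
Qed.

(** Descends the trace along [f]; the pick succeeds because [Tr x] is fixed by Frobenius. *)
Definition trace (x : E) : F := odflt 0 [pick a | f a == Tr x].

Lemma traceK x : f (trace x) = Tr x.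
Proof.
rewrite /trace; case: pickP => [a /eqP//|no].
by have [a fa] := fixed_base (conj_trace_frob f oE x); have := no a; rewrite fa eqxx.
Qed.

Lemma traceB x y : trace (x - y) = trace x - trace y.
Proof.
apply: (fmorph_inj f); rewrite rmorphB !traceK (conj_traceD f); congr (_ + _).
by have := conj_traceZ f m (-1) y; rewrite rmorphN1 !mulN1r.
Qed.

Lemma traceZ a x : trace (f a * x) = a * trace x.
Proof. by apply: (fmorph_inj f); rewrite rmorphM !traceK conj_traceZ. Qed.

Definition mul_trace_mx (x : E) : 'M[F]_(2, m + 1) :=
  row_mx (mul_mx 2 x) (\matrix_(i < 2, j < 1) ((i == 1)%:R * trace x)).

Lemma mul_trace_mxE (v : 'rV[F]_2) x :
  v *m mul_trace_mx x =
  row_mx (c ((f (v 0 0) + f (v 0 1) * th) * x)) (const_mx (v 0 1 * trace x)).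
Proof.
have lift01 : lift ord0 ord0 = 1 :> 'I_2 by exact: val_inj.
rewrite /mul_trace_mx mul_mx_row mul_mxE; congr (row_mx (c (_ * _)) _).
  by rewrite /poly_embed big_ord_recl big_ord1 expr0 mulr1 expr1 lift01.
apply/matrixP=> i j; rewrite !mxE big_ord_recl big_ord1 !mxE !ord1 lift01 /=.
by rewrite mul0r mulr0 add0r mul1r.
Qed.

(* The condition [w = v (A_y - A_x)] with [v = (b, 1) / t] reads
   [y = x + t om / (b + th)] where [om] depends only on [w], while the trace
   coordinate becomes a condition on [b] alone. *)
Lemma exists_AAD2 : (2 <= m)%N ->
  exists2 Fam : {set {vspace 'rV[F]_(2 + (m + 1))}},
    is_AAD 2 (m + m * m) Fam & (q ^ m.-1 <= #|Fam|)%N.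
Proof.
move=> m_ge2; have [z leX] := popular_norm; set X := finset _ in leX.
have embed0 a b : f a + f b * th = 0 -> a = 0 /\ b = 0.
  pose v : 'rV[F]_2 := \row_i (if i == 0 then a else b).
  move=> ab0; have /rowP v0 : v = 0.
    apply: poly_embed_eq0 => //; rewrite /poly_embed big_ord_recl big_ord1 !mxE /=.
    by rewrite expr0 mulr1 expr1.
  by have := v0 0; have := v0 1; rewrite !mxE /= => -> ->.
have trA : transverse mul_trace_mx.
  move=> x y v nxy; rewrite !mul_mx_row => /eq_row_mx[+ _].
  exact: (mul_mx_transverse m_ge2).
exists [set graph_sp (mul_trace_mx x) | x in X]%SET; last first.
  by rewrite card_imset //; exact: graph_inj.
apply: graph_AAD => // x w xX nz_w; set Y := [set y in X | _]%SET.
pose w' := rsubmx w 0 0.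
have YP y : y \in Y -> N y = z /\ exists a b,
    [/\ c ((f a + f b * th) * (y - x)) = lsubmx w & b * trace (y - x) = w'].
  rewrite !inE => /andP[/eqP Ny /existsP[v /eqP vw]]; split=> //.
  exists (v 0 0), (v 0 1); rewrite /w' -vw !mul_trace_mxE opp_row_mx add_row_mx.
  by rewrite row_mxKl row_mxKr !mxE mulrBr coordB traceB mulrBr.
have [-> | [y0 /YP[_ [a0 [b0 [w_y0 w'_y0]]]]]] := set_0Vmem Y.
  by rewrite cards0.
set om := (f a0 + f b0 * th) * (y0 - x) in w_y0.
(* If [om] vanished, then [b0 = 0] or [y0 = x]; either kills the trace coordinate as well, so [w]
   would be 0. *)
have nz_om : om != 0.
  apply: contraNneq nz_w => om0; rewrite -[w]hsubmxK -w_y0 om0 coord0.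
  have w'0 : w' = 0.
    move/eqP: om0; rewrite mulf_eq0 => /orP[/eqP/embed0[_ b00] | /eqP yx0].
      by rewrite -w'_y0 b00 mul0r.
    by rewrite -w'_y0 yx0 -(mul0r 0) -(rmorph0 f) traceZ mul0r mulr0.
  apply/eqP/rowP=> i; rewrite !mxE; case: splitP => j _; rewrite !mxE //.
  by move: w'0; rewrite /w' !mxE (ord1 j).
have omE y a b : c ((f a + f b * th) * (y - x)) = lsubmx w ->
    (f a + f b * th) * (y - x) = om by rewrite -w_y0 => /inj_c.
have nz_den b : f b + th != 0.
  apply/eqP=> b0'; have [] := @embed0 b 1; first by rewrite rmorph1 mul1r.
  by move=> _ /eqP; rewrite oner_eq0.
pose Bs := [set b | Tr (om / (f b + th)) == f w']%SET.
have card_Bs : (#|Bs| <= m)%N by exact: card_conj_trace_inv.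
pose Yw (u : E) := [set y in Y | [exists t, y == x + f t * u]]%SET.
have card_Yw u : u != 0 -> (#|Yw u| <= m)%N.
  move=> nz_u; apply: (card_norm_line nz_u (x := x) (z := z)) => y.
  rewrite inE => /andP[/YP[Ny _] /existsP[t /eqP yE]]; split=> //.
  by exists t.
(* The case [b = 0] gives the direction [om]. Otherwise [b (y - x) = om / (a / b + th)], whose trace
   must be [w'], so [a / b] lies in [Bs]: at most [1 + m] lines with at most [m] solutions each. *)
have sub : Y \subset Yw om :|: \bigcup_(b in Bs) Yw (om / (f b + th)).
  apply/fintype.subsetP=> y yY; have [Ny [a [b [/omE yE w'E]]]] := YP y yY.
  have [b0' | nz_b] := eqVneq b 0.
    apply/setUP; left; rewrite inE yY; apply/existsP; exists a^-1.
    have nz_a : a != 0.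
      by apply: contraNneq nz_om => a0'; rewrite -yE a0' b0' rmorph0 mul0r addr0 mul0r.
    rewrite -yE b0' rmorph0 mul0r addr0 mulrA -rmorphM mulVf // rmorph1 mul1r.
    by rewrite subrKC.
  have divE : om / (f (a / b) + th) = f b * (y - x).
    apply: (canLR (mulfK (nz_den _))); rewrite -yE.
    rewrite -[f a](_ : f b * f (a / b) = _); first by ring.
    by rewrite -rmorphM mulrC divfK.
  apply/setUP; right; apply/bigcupP; exists (a / b).
    by rewrite inE divE -traceK traceZ w'E.
  rewrite inE yY; apply/existsP; exists b^-1; rewrite divE mulrA -rmorphM.
  by rewrite mulVf // rmorph1 mul1r subrKC.
apply: leq_trans (subset_leq_card sub) _.
apply: leq_trans (leq_card_setU _ _).1 _; apply: leq_add; first exact: card_Yw.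
apply: (@leq_trans (\sum_(b in Bs) m)); last first.
  by rewrite sum_nat_const leq_mul2r card_Bs orbT.
elim/big_rec2: _ => [|b s1 S2 _ leS]; first by rewrite cards0.
rewrite (leq_trans (leq_card_setU _ _).1) // leq_add // card_Yw //.
by rewrite mulf_neq0 ?invr_eq0.
Qed.

End Constructions.

(** * Exponents *)

Lemma leq_mAS q n k L (Fam : {set {vspace 'rV[GF q]_n}}) :
  is_AS k L Fam -> (#|Fam| <= mAS q n k L)%N.
Proof. by move=> asF; rewrite /mAS (bigD1 Fam) //= leq_maxl. Qed.

Lemma leq_mAAD q n k L (Fam : {set {vspace 'rV[GF q]_n}}) :
  is_AAD k L Fam -> (#|Fam| <= mAAD q n k L)%N.
Proof. by move=> aadF; rewrite /mAAD (bigD1 Fam) //= leq_maxl. Qed.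

Lemma mAS_leq_mAAD q n k L : (0 < k)%N -> (mAS q n k L.+1 <= mAAD q n k L)%N.
Proof.
by move=> k_gt0; apply/bigmax_leqP => Fam /(AS_is_AAD k_gt0)/leq_mAAD.
Qed.

Lemma mAAD_upper q n k L : prime_power q -> (0 < k)%N -> (2 * k < n)%N ->
  (mAAD q n k L <= (2 * L + 1) * q ^ (n - 2 * k))%N.
Proof.
move=> ppq k_gt0 lt_kn; apply/bigmax_leqP => Fam /(leq_card_AAD k_gt0 lt_kn).
by rewrite card_GF.
Qed.

Lemma mAS_lower q k m L M : prime_power q -> (0 < k)%N -> (k <= m)%N ->
  (M <= q ^ m)%N ->
  (q ^ (k.+1 * m) * (2 * q ^ k * M) ^ L.+1 < q ^ (m * L.+1))%N ->
  (M <= mAS q (k + m) k L)%N.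
Proof.
move=> ppq k_gt0 le_km leM lt_q.
have m_gt0 : (0 < m)%N by exact: leq_trans le_km.
have [E [f [c [th [oE inj_c lin_c _ inj_th]]]]] :=
  finField_extension_coord (GF q) m_gt0.
rewrite -(card_GF ppq) in leM lt_q.
have [Fam asF <-] := exists_AS_random oE inj_c lin_c inj_th k_gt0 le_km leM lt_q.
exact: leq_mAS.
Qed.

Lemma mAS1_lower q m L : prime_power q -> (0 < m)%N -> (m < L)%N ->
  (q ^ m.-1 <= mAS q (1 + m) 1 L)%N.
Proof.
move=> ppq m_gt0 lt_mL.
have [E [f [c [th [oE inj_c lin_c fixF inj_th]]]]] :=
  finField_extension_coord (GF q) m_gt0.
have [Fam aadF] := exists_AAD1 m_gt0 oE inj_c lin_c fixF inj_th.
rewrite card_GF // => /leq_trans; apply; apply: leq_mAS.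
exact: sub_AS lt_mL (AAD1_is_AS aadF).
Qed.

Lemma mAAD2_lower q m L : prime_power q -> (2 <= m)%N -> (m + m * m <= L)%N ->
  (q ^ m.-1 <= mAAD q (2 + (m + 1)) 2 L)%N.
Proof.
move=> ppq m_ge2 le_mL; have m_gt0 : (0 < m)%N by exact: ltnW.
have [E [f [c [th [oE inj_c lin_c fixF inj_th]]]]] :=
  finField_extension_coord (GF q) m_gt0.
have [Fam aadF] := exists_AAD2 m_gt0 oE inj_c lin_c fixF inj_th m_ge2.
rewrite card_GF // => /leq_trans; apply; apply: leq_mAAD.
exact: sub_AAD le_mL aadF.
Qed.

Section Exponents.
Variable R : realType.

Lemma pAAD_upper n k L : (0 < k)%N -> (2 * k < n)%N ->
  (pAAD R n k L <= (n%:R - 2 * k%:R : R)%:E)%E.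
Proof.
move=> k_gt0 lt_kn.
have eE : n%:R - 2 * k%:R = (n - 2 * k)%N%:R :> R by rewrite natrB ?natrM // ltnW.
rewrite eE; apply: (@limsup_logb_le _ _ (2 * L + 1)%N%:R _ 0) => // [|q ppq _].
  by rewrite ler1n addn1.
by rewrite powR_mulrn // -natrX -natrM ler_nat mAAD_upper.
Qed.

Lemma pAS_le_pAAD n k L : (0 < k)%N -> (pAS R n k L.+1 <= pAAD R n k L)%E.
Proof. by move=> k_gt0; apply: le_limsup_logb => q _; exact: mAS_leq_mAAD. Qed.

Lemma pAS_lower k m L : (0 < k)%N -> (k < m)%N ->
  ((m%:R - k%:R - k.+1%:R * m%:R / L.+1%:R : R)%:E <= pAS R (k + m) k L)%E.
Proof.
move=> k_gt0 lt_km; set e := _ - _ / _.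
(* A nonpositive exponent carries no information, since the upper limit is at least 0. *)
have [e_le0 | e_gt0] := lerP e 0.
  by apply: le_trans (limsup_logb_ge0 _ _); rewrite lee_fin.
have [Q leQ] := eventually_small_log 4 e_gt0.
apply: (@limsup_logb_ge _ _ 8 _ Q) => // q ppq leQq.
have q_gt1 := prime_power_gt1 ppq.
have q_gt0 : 0 < q%:R :> R by rewrite ltr0n ltnW.
have qe_ge4 : 4 <= q%:R `^ e.
  by rewrite -ler_ln ?posrE ?powR_gt0 // ln_powR leQ.
have qe_gt0 : 0 < q%:R `^ e := powR_gt0 e q_gt0.
(* Dividing by 4 gives [2 * M < q ^ e], the strictness needed for counting, while [q ^ e >= 4] gives
   [M >= 1] and so [q ^ e < 4 * (M + 1) <= 8 * M]. *)
pose M := Num.truncn (q%:R `^ e / 4).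
have := truncn_itv (divr_ge0 (ltW qe_gt0) (ler0n R 4)).
rewrite -/M => /andP[leM]; rewrite -(natr1 M) => ltM.
have M_ge1 : 1 <= M%:R :> R by rewrite ler1n truncn_gt0 ler_pdivlMr ?mul1r.
apply: (@le_trans _ _ (8 * M%:R)); first by lra.
rewrite ler_pM2l // ler_nat; apply: mAS_lower => //; first exact: ltnW.
  rewrite -(ler_nat R) natrX -powR_mulrn ?ltW //.
  have : q%:R `^ e <= q%:R `^ m%:R.
    apply: ler_powR; first by rewrite ler1n ltnW.
    rewrite /e -addrA gerDl -opprD oppr_le0.
    by rewrite addr_ge0 // divr_ge0 // mulr_ge0.
  lra.
rewrite -(ltr_nat R) !(natrM, natrX).
have ltM' : (2 * q%:R ^+ k * M%:R) ^+ L.+1 < (q%:R ^+ k * q%:R `^ e) ^+ L.+1 :> R.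
  have qk_gt0 : 0 < q%:R ^+ k :> R by rewrite exprn_gt0.
  have lt2M : 2 * M%:R < q%:R `^ e by lra.
  rewrite ltr_pXn2r // ?nnegrE ?mulr_ge0 ?(ltW qk_gt0) ?powR_ge0 //.
  by rewrite mulrAC mulrC ltr_pM2l.
apply: (@lt_le_trans _ _ (q%:R ^+ (k.+1 * m) * (q%:R ^+ k * q%:R `^ e) ^+ L.+1)).
  by rewrite ltr_pM2l ?exprn_gt0.
rewrite -!powR_mulrn ?mulr_ge0 ?powR_ge0 ?(ltW q_gt0) //.
rewrite -powRD ?(gt_eqF q_gt0) ?implybT // -powRrM -powRD ?(gt_eqF q_gt0) ?implybT //.
(* The exponent [e] is the solution of [(k+1) m + (k+e) (L+1) = m (L+1)]. *)
rewrite le_eqVlt; apply/orP; left; apply/eqP; congr (_ `^ _).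
rewrite !natrM /e; have : L.+1%:R != 0 :> R by rewrite pnatr_eq0.
by move=> nzL; field.
Qed.

End Exponents.

Theorem mainTheorem1 (R : realType) :
  [/\ forall k n L : nat,
        (0 < k)%N -> (0 < n)%N -> (0 < L)%N -> (2 * k < n)%N ->
        [/\ (((n%:R - 2 * k%:R
               - (k%:R + 1) * (n%:R - k%:R) / (L%:R + 1) : R)%:E)
              <= pAS R n k L)%E,
            (pAS R n k L <= pAAD R n k (L - 1))%E
          & (pAAD R n k (L - 1) <= (n%:R - 2 * k%:R : R)%:E)%E],
      forall n L : nat, (3 <= n)%N -> (n <= L)%N ->
        pAS R n 1 L = (n%:R - 2 : R)%:E
    & forall n L : nat, (5 <= n)%N ->
        (4 * n%:Z ^+ 2 - 18 * n%:Z + 21 <= L%:Z)%R ->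
        pAAD R n 2 L = (n%:R - 4 : R)%:E].
Proof.
split=> [k n [//|L] k_gt0 _ _ lt_kn | n L n_ge3 le_nL | n L n_ge5 leL].
- rewrite subn1 /=; split; [|exact: pAS_le_pAAD|exact: pAAD_upper].
  have [m nE] : exists m, n = (k + m)%N by exists (n - k)%N; rewrite subnKC //; lia.
  subst n; have lt_km : (k < m)%N by lia.
  apply: le_trans (pAS_lower R L.+1 k_gt0 lt_km); rewrite lee_fin natrD !natr1.
  by rewrite le_eqVlt; apply/orP; left; apply/eqP; ring.
- case: L le_nL => [|L] le_nL; first by lia.
  apply/eqP; rewrite eq_le; apply/andP; split.
    have lt_2n : (2 * 1 < n)%N by lia.
    apply: le_trans (pAS_le_pAAD R n L (ltn0Sn 0)) _.
    by have := pAAD_upper R L (ltn0Sn 0) lt_2n; rewrite mulr1.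
  (* The extension has degree [m + 1 = n - 1]; the norm fibre gives [q ^ (n - 2)] members and AS
     bound [n]. *)
  have [m nE] : exists m, n = (1 + m.+1)%N by exists (n - 2)%N; lia.
  subst n; have -> : (1 + m.+1)%:R - 2 = m%:R :> R.
    by rewrite -natrB ?subn2 //.
  apply: (@limsup_logb_ge _ _ 1 _ 0) => // q ppq _.
  by rewrite mul1r powR_mulrn // -natrX ler_nat; apply: (@mAS1_lower q m.+1).
- apply/eqP; rewrite eq_le; apply/andP; split.
    have lt_4n : (2 * 2 < n)%N by lia.
    by have := pAAD_upper R L (ltn0Sn 1) lt_4n; rewrite -natrM.
  have [m nE] : exists m, n = (2 + (m.+1 + 1))%N by exists (n - 4)%N; lia.
  subst n; have -> : (2 + (m.+1 + 1))%:R - 4 = m%:R :> R.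
    by rewrite -natrB; [congr _%:R | ]; lia.
  apply: (@limsup_logb_ge _ _ 1 _ 0) => // q ppq _.
  rewrite mul1r powR_mulrn // -natrX ler_nat; apply: (@mAAD2_lower q m.+1) => //.
    by lia.
  (* The degree is [n - 3], so the construction needs [(n - 3) + (n - 3)^2 = n^2 - 5n + 6], which is
     below [4n^2 - 18n + 21]. *)
  by move: leL; rewrite expr2; nia.
Qed.
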